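(* Let there exist $\phi_0, \Phi_0, \omega_0, \Omega_0, t_0 > 0$ such that $$\phi_0 t \le \phi(t) \le \Phi_0 t, \quad \omega_0 t \le \omega(t) \le \Omega_0 t \quad \forall t \in [0, t_0].$$ Then the singular penalty function $F_{\lambda}$ is exact on $\Omega_{\delta} = \{ (x,p) \in A \times \mathbb{R}_+ \mid \varphi(x,p) < \delta \}$ for some $\delta > 0$ if and only if the penalty function $h_{\lambda}(x) = f(x) + \lambda\, d(0, G(x))$ is exact on the set $\{ x \in A \mid d(0, G(x)) < \theta \}$ for some $\theta > 0$.
   Context: Setting. $X$ is a metric space, $Y$ a normed space, $A \subset X$ nonempty, $f \colon X \to \mathbb{R} \cup \{+\infty\}$, and $G \colon X \rightrightarrows Y$ a set-valued mapping with closed values. The problem $(\mathcal{P})$ is: minimize $f(x)$ subject to $0 \in G(x)$, $x \in A$; its feasible set is $\Omega = \{x \in A : 0 \in G(x)\}$. It is assumed that $f$ attains a global minimum on $\Omega$, with finite value $f^*$. $\mathbb{R}_+ = [0,+\infty)$. Singular penalty function. Fix $w \in Y$ and non-decreasing functions $\phi \colon [0, +\infty] \to [0, +\infty]$, $\omega \colon \mathbb{R}_+ \to [0, +\infty]$ such that $\phi(t) = 0$ iff $t = 0$ and $\omega(t) = 0$ iff $t = 0$. For $(x,p) \in X \times \mathbb{R}_+$ put $\varphi(x,p) = 0$ if $x \in \Omega$, $p = 0$; $\varphi(x,p) = +\infty$ if $x \notin \Omega$, $p = 0$; and $\varphi(x,p) = p^{-1} \phi( d(0, G(x) - p w)^2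 ) + \omega(p)$ if $p > 0$, where $d(0, G(x) - pw) = \inf_{y \in G(x)} \|y - pw\|$ if $G(x) \neq \emptyset$, and $= +\infty$ if $G(x) = \emptyset$. The singular penalty function is $F_\lambda(x,p) = f(x) + \lambda \varphi(x,p)$, $\lambda \ge 0$. Exactness on a set: $F_\lambda$ is exact on $S \subset A \times \mathbb{R}_+$ if there exists $\lambda_0 \ge 0$ such that $F_{\lambda_0}(x,p) \ge f^*$ for all $(x,p) \in S$; similarly $h_\lambda$ is exact on $S \subset A$ if there exists $\lambda_0 \ge 0$ such that $h_{\lambda_0}(x) \ge f^*$ for all $x \in S$. *)

(* Defs.v *)
From HB Require Import structures.
From mathcomp Require Import all_boot all_order all_algebra.
From mathcomp Require Import all_classical all_reals all_analysis.

Set Implicit Arguments.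
Unset Strict Implicit.
Unset Printing Implicit Defensive.

Import Order.TTheory GRing.Theory Num.Theory.
Import numFieldNormedType.Exports.

Local Open Scope classical_set_scope.
Local Open Scope ring_scope.
Local Open Scope ereal_scope.

Definition feasible (R : realType) (X : Type) (Y : normedModType R)
    (A : set X) (G : X -> set Y) : set X :=
  [set x | A x /\ G x 0%R].

(* [ereal_inf set0 = +oo], so the distance to an empty set is [+oo]. *)
Definition dist0 (R : realType) (Y : normedModType R) (B : set Y) : \bar R :=
  ereal_inf [set `|y|%:E | y in B].

Definition translate (R : realType) (Y : normedModType R)
    (B : set Y) (v : Y) : set Y :=
  [set (y - v)%R | y in B].

Definition is_min_value (R : realType) (X : Type)
    (f : X -> \bar R) (S : set X) (fstar : R) : Prop :=
  (exists2 x, S x & f x = fstar%:E) /\ (forall x, S x -> fstar%:E <= f x).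

(* Only meaningful for [0 <= p]; the values at [p < 0] are junk and are never
   used, since [F] is only considered on subsets of [A * R_+]. *)
Definition varphi (R : realType) (X : Type) (Y : normedModType R)
    (A : set X) (G : X -> set Y) (w : Y)
    (phi : \bar R -> \bar R) (omega : R -> \bar R) (x : X) (p : R) : \bar R :=
  if p == 0%R then
    (if x \in feasible A G then 0 else +oo)
  else
    (p^-1)%:E * phi (dist0 (translate (G x) (p *: w)%R) ^+ 2) + omega p.

(* Here [0 * +oo = 0]. *)
Definition singular_penalty (R : realType) (X : Type) (Y : normedModType R)
    (f : X -> \bar R) (A : set X) (G : X -> set Y) (w : Y)
    (phi : \bar R -> \bar R) (omega : R -> \bar R)
    (lambda : R) (xp : X * R) : \bar R :=
  f xp.1 + lambda%:E * varphi A G w phi omega xp.1 xp.2.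

Definition penalty (R : realType) (X : Type) (Y : normedModType R)
    (f : X -> \bar R) (G : X -> set Y) (lambda : R) (x : X) : \bar R :=
  f x + lambda%:E * dist0 (G x).

Definition exact_on (R : realType) (T : Type)
    (P : R -> T -> \bar R) (fstar : R) (S : set T) : Prop :=
  exists lambda0 : R,
    (0 <= lambda0)%R /\ forall z, S z -> fstar%:E <= P lambda0 z.

(* Main.v *)
(* By AM-GM, any upper bound D <= E + p |w| with E = d(0, G x - p w) is
   O(E^2 / p + p) = O(varphi(x, p)), so D = d(0, G x) is dominated by varphi;
   conversely, the choice p = D gives varphi(x, p) = O(D).  Hence each penalty
   function dominates the other one after rescaling lambda, and closedness of
   G x covers the case D = 0. *)
Require Import Defs.
From HB Require Import structures.
From mathcomp Require Import all_boot all_order all_algebra.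
From mathcomp Require Import all_classical all_reals all_analysis.
From mathcomp Require Import ring lra.

Import Order.TTheory GRing.Theory Num.Theory.
Import numFieldNormedType.Exports.

Local Open Scope classical_set_scope.
Local Open Scope ring_scope.
Local Open Scope ereal_scope.

Lemma dist0_ge0 (R : realType) (Y : normedModType R) (B : set Y) :
  0 <= dist0 B.
Proof. by apply: le_ereal_inf_tmp => _ [y _ <-]; rewrite lee_fin. Qed.

Lemma closed_dist0_eq0 (R : realType) (Y : normedModType R) (B : set Y) :
  closed B -> dist0 B = 0 -> B 0%R.
Proof.
move=> cB B0; apply: cB => U /nbhs_ballP[e /= e0 eU].
have : dist0 B < e%:E by rewrite B0 lte_fin.
move=> /ereal_inf_lt[_ [y By <-]]; rewrite lte_fin => ye.
by exists y; split=> //; apply: eU; rewrite -ball_normE /= sub0r normrN.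
Qed.

Lemma dist0_translate_le (R : realType) (Y : normedModType R) (B : set Y)
    (v : Y) :
  dist0 (translate B v) <= dist0 B + `|v|%:E.
Proof.
rewrite -leeBlDr//; apply: le_ereal_inf_tmp => _ [y By <-].
rewrite leeBlDr//; apply: (@le_trans _ _ `|y - v|%:E).
  by apply: ereal_inf_lbound; exists (y - v)%R => //; exists y.
by rewrite -EFinD lee_fin ler_normB.
Qed.

Lemma translateK (R : realType) (Y : normedModType R) (B : set Y) (v : Y) :
  translate (translate B v) (- v)%R = B.
Proof.
apply/seteqP; split=> [_ [_ [y By <-] <-]|y By]; first by rewrite opprK subrK.
by exists (y - v)%R; [exists y|rewrite opprK subrK].
Qed.

(** Translating back by [- v] turns the previous bound into this one. *)
Lemma dist0_le_translate (R : realType) (Y : normedModType R) (B : set Y)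
    (v : Y) :
  dist0 B <= dist0 (translate B v) + `|v|%:E.
Proof.
by rewrite -{1}(translateK _ _ B v) -(normrN v); exact: dist0_translate_le.
Qed.

(** After multiplication by [p] this is [e * p <= e ^+ 2 + p ^+ 2], a weak form of AM-GM. *)
Lemma le_sqr_div_add (R : realFieldType) (e p : R) :
  (0 < p -> e <= e ^+ 2 / p + p)%R.
Proof.
move=> p0; rewrite -(ler_pM2r p0) mulrDl divfK ?gt_eqF//.
nra.
Qed.

(** With [p] equal to the distance [dist0 (G x)], the shifted distance is at most
    [q = p * (1 + |w|)], so the first term of [varphi] is at most [Phi0 * q ^+ 2 / p], which is
    linear in [p]. *)
Lemma varphi_le (R : realType) (X : Type) (Y : normedModType R) (A : set X)
    (G : X -> set Y) (w : Y) (phi : \bar R -> \bar R) (omega : R -> \bar R)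
    (Phi0 Omega0 t0 : R) (x : X) (p : R) :
  (forall s t, 0 <= s -> s <= t -> phi s <= phi t) ->
  (forall t : R, (0 <= t <= t0)%R -> phi t%:E <= (Phi0 * t)%:E) ->
  (forall t : R, (0 <= t <= t0)%R -> omega t <= (Omega0 * t)%:E) ->
  (0 < p)%R -> dist0 (G x) = p%:E ->
  (p * (1 + `|w|) <= 1)%R -> (p * (1 + `|w|) <= t0)%R ->
  varphi A G w phi omega x p
    <= ((Phi0 * (1 + `|w|) ^+ 2 + Omega0) * p)%:E.
Proof.
move=> phi_nd phi_le omega_le p0 Dp p1 pt0.
have w0 : (0 <= `|w|)%R by [].
set q := (p * (1 + `|w|))%R in p1 pt0.
have q0 : (0 <= q)%R by rewrite /q; nra.
have Eq : dist0 (translate (G x) (p *: w)%R) <= q%:E.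
  apply: le_trans (dist0_translate_le _ _ _ _) _.
  by rewrite Dp -EFinD normrZ gtr0_norm// lee_fin /q mulrDr mulr1.
have E0 := dist0_ge0 _ _ (translate (G x) (p *: w)%R).
rewrite /varphi gt_eqF// mulrDl EFinD; apply: leeD; last first.
  by apply: omega_le; rewrite ltW//=; apply: le_trans pt0; rewrite /q; nra.
have phiE : phi (dist0 (translate (G x) (p *: w)%R) ^+ 2)
    <= (Phi0 * q ^+ 2)%:E.
  apply: (@le_trans _ _ (phi (q ^+ 2)%:E)).
    apply: phi_nd; first by rewrite expe2 mule_ge0.
    by rewrite expe2 expr2 EFinM lee_pmul.
  (* The growth bound is needed at [q ^+ 2], not at [q]: [q <= 1] and [q <= t0] together give
     [q ^+ 2 <= t0]. *)
  by apply: phi_le; rewrite sqr_ge0/=; nra.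
apply: (@le_trans _ _ ((p^-1)%:E * (Phi0 * q ^+ 2)%:E)).
  by apply: lee_wpmul2l => //; rewrite lee_fin invr_ge0 ltW.
rewrite -EFinM lee_fin le_eqVlt; apply/orP; left; apply/eqP.
by rewrite /q; field; rewrite gt_eqF.
Qed.

(** The two upper bounds on [varphi] force [p] and the squared shifted distance below [t0], where
    the linear lower bounds on [omega] and [phi] hold; AM-GM then concludes. *)
Lemma dist0_le_varphi (R : realType) (X : Type) (Y : normedModType R)
    (A : set X) (G : X -> set Y) (w : Y) (phi : \bar R -> \bar R)
    (omega : R -> \bar R) (phi0 omega0 t0 : R) (x : X) (p : R) :
  (forall t, 0 <= t -> 0 <= phi t) ->
  (forall s t, 0 <= s -> s <= t -> phi s <= phi t) ->
  (forall t : R, (0 <= t)%R -> 0 <= omega t) ->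
  (forall s t : R, (0 <= s)%R -> (s <= t)%R -> omega s <= omega t) ->
  (forall t : R, (0 <= t <= t0)%R -> (phi0 * t)%:E <= phi t%:E) ->
  (forall t : R, (0 <= t <= t0)%R -> (omega0 * t)%:E <= omega t) ->
  (0 < phi0)%R -> (0 < omega0)%R -> (0 < t0)%R -> (0 < p)%R ->
  varphi A G w phi omega x p < (omega0 * t0)%:E ->
  varphi A G w phi omega x p < phi0%:E ->
  dist0 (G x)
    <= (phi0^-1 + (1 + `|w|) / omega0)%:E * varphi A G w phi omega x p.
Proof.
move=> phi_ge0 phi_nd omega_ge0 omega_nd phi_ge omega_ge f0 o0 t00 p0.
rewrite /varphi gt_eqF//.
have := dist0_le_translate _ _ (G x) (p *: w)%R.
have := dist0_ge0 _ _ (translate (G x) (p *: w)%R).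
set E := dist0 (translate _ _) => E0 DE V1 V2.
have w0 : (0 <= `|w|)%R by [].
have pV : (0 <= p^-1)%R by rewrite invr_ge0 ltW.
have E20 : 0 <= E ^+ 2 by rewrite expe2 mule_ge0.
have a0 : 0 <= (p^-1)%:E * phi (E ^+ 2) by rewrite mule_ge0// phi_ge0.
have b0 : 0 <= omega p by rewrite omega_ge0// ltW.
(* Otherwise monotonicity gives [omega0 * t0 <= omega t0 <= omega p <= varphi], against the first
   bound. *)
have pt0 : (p < t0)%R.
  rewrite ltNge; apply/negP => t0p.
  have : (omega0 * t0)%:E < (omega0 * t0)%:E.
    apply: le_lt_trans V1; apply: le_trans (leeDr _ a0).
    apply: (@le_trans _ _ (omega t0)); last by apply: omega_nd => //; exact: ltW.
    by apply: omega_ge; rewrite lexx ltW.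
  by rewrite ltxx.
(* Otherwise [phi (E ^+ 2) >= phi0 * t0], and dividing by [p < t0] makes [varphi] at least [phi0],
   against the second bound. *)
have Et0 : E ^+ 2 < t0%:E.
  rewrite ltNge; apply/negP => t0E.
  have : phi0%:E < phi0%:E.
    apply: le_lt_trans V2; apply: le_trans (leeDl _ b0).
    apply: (@le_trans _ _ ((p^-1)%:E * (phi0 * t0)%:E)).
      rewrite -EFinM lee_fin mulrCA -[leLHS]mulr1 ler_pM2l//.
      by rewrite mulrC ler_pdivlMr// mul1r ltW.
    apply: lee_wpmul2l; first by rewrite lee_fin.
    apply: (@le_trans _ _ (phi t0%:E)).
      by apply: phi_ge; rewrite lexx ltW.
    by apply: phi_nd => //; rewrite lee_fin ltW.
  by rewrite ltxx.
(* [Et0] excludes [E = +oo] and [E0] excludes [E = -oo]. *)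
case: E E0 DE Et0 E20 {V1 V2 a0} => [e| |]// e0 DE Et0 E20.
rewrite lee_fin in e0.
have Ee : e%:E ^+ 2 = (e ^+ 2)%:E by rewrite expe2 -EFinM expr2.
move: Et0; rewrite Ee lte_fin => et0.
apply: (le_trans DE).
apply: (@le_trans _ _ ((phi0^-1 + (1 + `|w|) / omega0)%:E *
    (p^-1 * (phi0 * e ^+ 2) + omega0 * p)%:E)); last first.
  apply: lee_wpmul2l.
    by rewrite lee_fin ltW// addr_gt0 ?divr_gt0 ?invr_gt0 ?ltr_pwDl.
  rewrite EFinD EFinM; apply: leeD.
    by apply: lee_wpmul2l; rewrite ?lee_fin// phi_ge// sqr_ge0/= ltW.
  by apply: omega_ge; rewrite !ltW.
rewrite -EFinD -EFinM lee_fin normrZ gtr0_norm//.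
(* In the expanded product, [phi0^-1] normalizes the [e ^+ 2] term and [(1 + |w|) / omega0] turns
   [omega0 * p] into [p + p * |w|]. The two cross terms are nonnegative and are dropped. *)
have -> : ((phi0^-1 + (1 + `|w|) / omega0) *
      (p^-1 * (phi0 * e ^+ 2) + omega0 * p) =
    (e ^+ 2 / p + p + p * `|w|) +
    (phi0^-1 * (omega0 * p) + (1 + `|w|) / omega0 * (p^-1 * (phi0 * e ^+ 2))))%R.
  by field; rewrite !gt_eqF.
rewrite -[leLHS]addr0 lerD ?lerD ?le_sqr_div_add//.
have w1 : (0 <= 1 + `|w|)%R by rewrite addr_ge0.
by rewrite addr_ge0// !mulr_ge0 ?invr_ge0 ?sqr_ge0// ltW.
Qed.

Theorem theorem4p7 (R : realType) (X : metricType R) (Y : normedModType R)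
    (A : set X) (f : X -> \bar R) (G : X -> set Y) (fstar : R)
    (w : Y) (phi : \bar R -> \bar R) (omega : R -> \bar R)
    (A_neq0 : A !=set0)
    (f_neqNy : forall x, f x != -oo)
    (G_closed : forall x, closed (G x))
    (f_min : is_min_value f (feasible A G) fstar)
    (phi_ge0 : forall t, 0 <= t -> 0 <= phi t)
    (phi_nd : forall s t, 0 <= s -> s <= t -> phi s <= phi t)
    (phi_eq0 : forall t, 0 <= t -> (phi t = 0 <-> t = 0))
    (omega_ge0 : forall t : R, (0 <= t)%R -> 0 <= omega t)
    (omega_nd : forall s t : R, (0 <= s)%R -> (s <= t)%R -> omega s <= omega t)
    (omega_eq0 : forall t : R, (0 <= t)%R -> (omega t = 0 <-> t = 0%R))
    (growth : exists phi0 Phi0 omega0 Omega0 t0 : R,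
       [/\ (0 < phi0)%R, (0 < Phi0)%R, (0 < omega0)%R, (0 < Omega0)%R &
           (0 < t0)%R] /\
       forall t : R, (0 <= t <= t0)%R ->
         (phi0 * t)%:E <= phi t%:E <= (Phi0 * t)%:E /\
         (omega0 * t)%:E <= omega t <= (Omega0 * t)%:E) :
  (exists delta : R, (0 < delta)%R /\
     exact_on (singular_penalty f A G w phi omega) fstar
       [set xp | [/\ A xp.1, (0 <= xp.2)%R &
                     varphi A G w phi omega xp.1 xp.2 < delta%:E]])
  <->
  (exists theta : R, (0 < theta)%R /\
     exact_on (penalty f G) fstar
       [set x | A x /\ dist0 (G x) < theta%:E]).
Proof.
have [phi0 [Phi0 [omega0 [ Omega0 [t0 [[f0 F0 o0 O0 t00] gr]]]]]] := growth.
have w0 : (0 <= `|w|)%R by [].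
have w1 : (0 < 1 + `|w|)%R by rewrite ltr_pwDl.
case: f_min => _ f_ge.
split=> [[delta [d0 [lambda [l0 exF]]]]|[theta [th0 [lambda [l0 exh]]]]].
- pose C : R := (Phi0 * (1 + `|w|) ^+ 2 + Omega0)%R.
  have C0 : (0 < C)%R by rewrite addr_gt0// mulr_gt0// exprn_gt0.
  (* For [p = dist0 (G x)], the first bound gives [C * p < delta], so that [(x, p)] lies in the set
     where [F] is exact; the second gives the two smallness conditions of [varphi_le]. *)
  exists (Num.min (delta / C) (Num.min 1 t0 / (1 + `|w|)))%R; split.
    by rewrite lt_min !divr_gt0// lt_min ltr01.
  exists (lambda * C)%R; split; first by rewrite mulr_ge0// ltW.
  move=> x [/= Ax]; rewrite /penalty.
  have := dist0_ge0 _ _ (G x).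
  case Dx : (dist0 (G x)) => [p| |]//; rewrite lee_fin lte_fin.
  rewrite lt_min !ltr_pdivlMr// lt_min => p_ge0 /andP[pC /andP[p1 pt0]].
  (* The parameter [p = 0] must be treated apart: there [x] is feasible because [G x] is closed. *)
  have [p_eq0|p_neq0] := eqVneq p 0%R.
    rewrite p_eq0 mule0 adde0; apply: f_ge; split=> //.
    by apply: closed_dist0_eq0; rewrite ?Dx ?p_eq0.
  have p0 : (0 < p)%R by rewrite lt_neqAle eq_sym p_neq0.
  have VC : varphi A G w phi omega x p <= (C * p)%:E.
    apply: (varphi_le _ _ _ _ _ _ _ _ _ _ t0) => //; last 2 first.
    + exact: ltW.
    + exact: ltW.
    + by move=> t /gr [/andP[]].
    + by move=> t /gr [_ /andP[]].
  apply: (@le_trans _ _ (singular_penalty f A G w phi omega lambda (x, p))).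
    apply: exF; split=> //=; apply: le_lt_trans VC _.
    by rewrite lte_fin mulrC.
  rewrite /singular_penalty /=; apply: leeD => //.
  by rewrite -EFinM -mulrA EFinM; apply: lee_wpmul2l.
- pose C : R := (phi0^-1 + (1 + `|w|) / omega0)%R.
  have C0 : (0 < C)%R by rewrite addr_gt0 ?divr_gt0 ?invr_gt0.
  (* The first bound gives [C * varphi < theta], hence [dist0 (G x) < theta]; the other two are the
     thresholds of [dist0_le_varphi]. *)
  exists (Num.min (theta / C) (Num.min (omega0 * t0) phi0))%R; split.
    by rewrite !lt_min divr_gt0// mulr_gt0.
  exists (lambda * C)%R; split; first by rewrite mulr_ge0// ltW.
  move=> [x p] [/= Ax p_ge0]; rewrite /singular_penalty /=.
  (* At [p = 0] an infeasible [x] has [varphi = +oo], which the strict bound rules out. *)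
  have [->|p_neq0] := eqVneq p 0%R.
    rewrite /varphi eqxx; case: ifPn => // /set_mem xO _.
    by rewrite mule0 adde0; exact: f_ge.
  have p0 : (0 < p)%R by rewrite lt_neqAle eq_sym p_neq0.
  rewrite !EFin_min !lt_min => /andP[VC /andP[V1 V2]].
  have DV : dist0 (G x) <= C%:E * varphi A G w phi omega x p.
    apply: (dist0_le_varphi _ _ _ _ _ _ _ _ _ _ t0) => //.
    + by move=> t /gr [/andP[]].
    + by move=> t /gr [_ /andP[]].
  apply: (@le_trans _ _ (penalty f G lambda x)).
    apply: exh; split=> //; apply: le_lt_trans DV _.
    by rewrite muleC -lte_pdivlMr// -EFinM.
  rewrite /penalty; apply: leeD => //.
  by rewrite EFinM -muleA; apply: lee_wpmul2l.
Qed.
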